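(* Let $F$ be a field, let $D$ be a central division algebra of degree $d$ over $F$, let $n$ be a positive integer, and let $\phi(z)=z^n+c_{n-1}z^{n-1}+\dots+c_0$ be a standard polynomial with $c_0,\dots,c_{n-1}\in D$. Let $\Phi(z)\in F[z]$ be the companion polynomial of $\phi(z)$. Then every root of $\phi(z)$ in $D$ is also a root of $\Phi(z)$, and each conjugacy class (in $D$) of roots of $\Phi(z)$ in $D$ contains a root of $\phi(z)$.
   Context: A central division algebra $D$ over $F$ is a division algebra with center $F$ and of finite dimension over $F$; its degree is $d=\sqrt{[D:F]}$. A standard polynomial over $D$ is a monic polynomial whose coefficients appear on the left of the variable; a root is an element $\lambda\in D$ with $\phi(\lambda)=\lambda^n+c_{n-1}\lambda^{n-1}+\dots+c_0=0$. Two elements $d_1,d_2\in D$ are conjugate if $d_1=qd_2q^{-1}$ for some nonzero $q\in D$. The companion matrix of $\phi$ is $$C_\phi=\begin{pmatrix}0&1&0&\dots&0\\0&0&1&&0\\ \vdots&&&\ddots&\\0&0&\dots&0&1\\-c_0&-c_1&\dots&-c_{n-2}&-c_{n-1}\end{pmatrix}\in M_n(D).$$ The companion polynomial $\Phi(z)$ of $\phi(z)$ is the characteristic polynomial of $C_\phi$, defined as follows. Let $K$ be a maximal subfield of $D$. Then the space of column vectors $D^n$ is a right $K$-vector space of dimension $nd$; fix a $K$-linear isomorphism $g:D^n\to K^{nd}$. For $A\in M_n(D)$, left multiplication by $A$ is right $K$-linear on $D^n$, so there is a unique $f(A)\in M_{nd}(K)$ with $g(Av)=f(A)g(v)$ for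 all $v\in D^n$. The characteristic polynomial of $A$ is $\det(f(A)-zI)$. It is a known fact that its coefficients lie in $F$ and that it is independent of the choices of $K$ and $g$. Thus $\Phi(z)=\det(f(C_\phi)-zI)$ has degree $nd$ and coefficients in $F$, so it can be evaluated at elements of $D$ and its set of roots in $D$ is closed under conjugation. *)

(* Defs.v *)
From HB Require Import structures.
From mathcomp Require Import all_boot all_order all_algebra all_field.

Set Implicit Arguments.
Unset Strict Implicit.
Unset Printing Implicit Defensive.

Import GRing.Theory.
Local Open Scope ring_scope.

Definition central_division (F : fieldType) (D : falgType F) : Prop :=
  (forall x : D, x != 0 -> x \is a GRing.unit) /\
  (forall x : D, (forall y : D, x * y = y * x) -> exists a : F, x = a%:A).

Definition division_degree (F : fieldType) (D : falgType F) (d : nat) : Prop :=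
  \dim {:D} = (d ^ 2)%N.

Definition conjugate (F : fieldType) (D : falgType F) (x y : D) : Prop :=
  exists2 q : D, q != 0 & x = q * y * q^-1.

(* In a finite-dimensional central division algebra, the commutative
   F-subalgebras are exactly the subfields containing F.  A maximal subfield
   necessarily contains F, so maximality may be tested among those. *)
Definition commutative_subalg (F : fieldType) (D : falgType F)
    (K : {aspace D}) : Prop :=
  {in K &, forall x y, x * y = y * x}.

Definition maximal_subfield (F : fieldType) (D : falgType F)
    (K : {aspace D}) : Prop :=
  commutative_subalg K /\
  forall L : {aspace D}, commutative_subalg L -> (K <= L)%VS -> L = K.

(* A maximal subfield K seen as a type; it carries a field structure, which
   depends on the proofs that D is a division algebra and K is commutative. *)
Definition subfield_type (F : fieldType) (D : falgType F)
    (hD : central_division D) (K : {aspace D}) (hK : maximal_subfield K) :=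
  subvs_of K.

Section SubfieldType.
Variables (F : fieldType) (D : falgType F) (hD : central_division D).
Variables (K : {aspace D}) (hK : maximal_subfield K).
Local Notation Kt := (subfield_type hD hK).

HB.instance Definition _ := Falgebra.copy Kt (subvs_of K).

Fact subfield_mulC : commutative (@GRing.mul Kt).
Proof. by move=> x y; apply: val_inj; apply: hK.1; apply: subvsP. Qed.

HB.instance Definition _ :=
  GRing.PzRing_hasCommutativeMul.Build Kt subfield_mulC.

Fact subfield_fieldP : GRing.field_axiom Kt.
Proof.
move=> x nz_x.
have Ux : vsval x \is a GRing.unit.
  by apply: hD.1; apply: contraNneq nz_x => x0; apply/eqP/val_inj.
have inj : (lker (amull x) == 0)%VS.
  apply/lker0P => u v; rewrite !lfunE /= => /(congr1 vsval) /= xuv.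
  by apply: val_inj; apply: (mulrI Ux).
have /memv_imgP[u _ xu1] : (1 : Kt) \in limg (amull x).
  have -> : limg (amull x) = fullv.
    apply/eqP; rewrite eqEdim subvf limg_dim_eq ?leqnn //.
    by rewrite (eqP inj) capv0.
  exact: memvf.
rewrite lfunE /= in xu1; apply/unitrP; exists u.
by rewrite [u * x]mulrC -xu1.
Qed.

HB.instance Definition _ := GRing.ComUnitRing_isField.Build Kt subfield_fieldP.

Definition subfield_val (k : Kt) : D := vsval (k : subvs_of K).

(* D^n as a right K-vector space. *)
Definition rscale_col (n : nat) (v : 'cV[D]_n) (k : Kt) : 'cV[D]_n :=
  \col_i (v i 0 * subfield_val k).

Definition right_linear_iso (n m : nat) (g : 'cV[D]_n -> 'cV[Kt]_m) : Prop :=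
  [/\ forall u v, g (u + v) = g u + g v,
      forall v k, g (rscale_col v k) = k *: g v
    & bijective g].

(* M is the matrix f(A) determined by the coordinate isomorphism g. *)
Definition represents (n m : nat) (g : 'cV[D]_n -> 'cV[Kt]_m)
    (A : 'M[D]_n) (M : 'M[Kt]_m) : Prop :=
  forall v, g (A *m v) = M *m g v.

(* det (M - z I); the library's char_poly is det (z I - M). *)
Definition det_sub_z (m : nat) (M : 'M[Kt]_m) : {poly Kt} :=
  \det (map_mx polyC M - 'X%:M).

End SubfieldType.

(* Phi in F[z] is the characteristic polynomial of A in M_n(D), computed
   through some maximal subfield K and some coordinate isomorphism g; Phi does
   not depend on K and g, and the determinant always has coefficients in F. *)
Definition char_poly_div (F : fieldType) (D : falgType F)
    (hD : central_division D) (d n : nat) (A : 'M[D]_n) (Phi : {poly F}) :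
    Prop :=
  exists (K : {aspace D}) (hK : maximal_subfield K)
         (g : 'cV[D]_n -> 'cV[subfield_type hD hK]_(n * d))
         (M : 'M[subfield_type hD hK]_(n * d)),
    [/\ right_linear_iso g, represents g A M
      & map_poly (in_alg (subfield_type hD hK)) Phi = det_sub_z M].

Definition companion_poly (F : fieldType) (D : falgType F)
    (hD : central_division D) (d : nat) (phi : {poly D}) (Phi : {poly F}) :
    Prop :=
  char_poly_div hD d (companionmx phi) Phi.

(* Evaluation p.[x] in {poly D} puts the coefficients on the left of x. *)
Definition root_in (F : fieldType) (D : falgType F) (Phi : {poly F})
    (x : D) : Prop :=
  root (map_poly (in_alg D) Phi) x.

(* Main.v *)
(* A nonzero column v with C_phi v = v x has entries v_i = q x^i, and its last
   row says that q x q^-1 is a root of phi; conversely a root x of phi gives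
   the eigenvector (x^i)_i, on which Phi(C_phi) = 0 acts as Phi(x).  So a root x
   of Phi must be turned into such an eigenvector.  Let p be the annihilator of
   x of least degree over F.  Since p divides Phi, det p(f(C)) = 0, hence
   p(C) w = 0 for some w != 0.  As p(x) = 0, the operator p(C) on columns is
   v |-> C v - v x composed with a commuting operator S, so S(w d) is an
   eigenvector for every d in D.  Some S(w d) is nonzero, because
   sum_i a_i d x^i = 0 for all d, with the powers x^i independent over the
   centre, forces all a_i = 0. *)
Require Import Defs.
From HB Require Import structures.
From mathcomp Require Import all_boot all_order all_algebra all_field.
From Stdlib Require Import Classical.

Set Implicit Arguments.
Unset Strict Implicit.
Unset Printing Implicit Defensive.

Import GRing.Theory.
Local Open Scope ring_scope.

(** * Polynomials in a matrix over a field *)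

(** Factor theorem over a matrix ring: X is central, so X - M divides p(X) - p(M), and Horner's
    scheme builds the quotient. *)
Lemma char_poly_mx_dvd (R : comNzRingType) (m : nat) (M : 'M[R]_m.+1)
    (p : {poly R}) :
  exists Q, p%:M - map_mx polyC (horner_mx M p) = char_poly_mx M * Q.
Proof.
elim/poly_ind: p => [|p c [Q IH]].
  by exists 0; rewrite mulr0 (rmorph0 (horner_mx M)) map_mx0 raddf0 subrr.
exists (p%:M + Q * map_mx polyC M).
rewrite mulrDr mulrA -IH (rmorphD (horner_mx M)) (rmorphM (horner_mx M)) /=.
rewrite horner_mx_X horner_mx_C map_mxD map_scalar_mx.
rewrite map_mxM raddfD /= opprD addrACA subrr addr0.
have -> : char_poly_mx M * p%:M = p%:M * char_poly_mx M.
  by rewrite -!mulmxE scalar_mxC.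
by rewrite scalar_mxM mulmxE /char_poly_mx mulrBl mulrBr addrA subrK.
Qed.

(** Stays inside K: taking determinants in the factor theorem, [char_poly M], hence p, divides
    det(p(X) I - p(M)). *)
Lemma det_horner_mx_eq0 (K : fieldType) (m : nat) (M : 'M[K]_m.+1)
    (p : {poly K}) :
  p %| char_poly M -> (1 < size p)%N -> \det (horner_mx M p) = 0.
Proof.
move=> p_dvd p_gt1; set B := horner_mx M p.
(* p divides charpoly_B(p), whose residue modulo p is charpoly_B(0). *)
have dvd_comp : p %| char_poly B \Po p.
  have [Q /(congr1 (fun A => \det A))] := char_poly_mx_dvd M p.
  rewrite det_mulmx => eqQ; apply: dvdp_trans p_dvd _.
  suff -> : char_poly B \Po p = char_poly M * \det Q by apply: dvdp_mulr.
  rewrite -eqQ -[LHS]det_map_mx /char_poly_mx map_mxB map_scalar_mx /=.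
  rewrite comp_polyX -map_mx_comp.
  by congr (\det (_ - _)); apply/matrixP=> i j; rewrite !mxE /= comp_polyC.
have [q eq_q]: exists q, char_poly B = q * 'X + ((char_poly B)`_0)%:P.
  elim/poly_ind: (char_poly B) => [|q c _].
    by exists 0; rewrite mul0r coef0 addr0.
  by exists q; rewrite coefD coefMX coefC add0r.
move: dvd_comp; rewrite eq_q comp_polyD comp_polyM comp_polyX comp_polyC.
rewrite dvdp_addr ?dvdp_mull // => /(dvdp_leq _) le.
have /eqP := char_poly_det B; have -> : (char_poly B)`_0 = 0.
  apply/eqP/negPn/negP => nz; have := le; rewrite polyC_eq0 nz size_polyC nz.
  by move/(_ isT); rewrite leqNgt p_gt1.
by rewrite eq_sym mulf_eq0 signr_eq0 => /eqP.
Qed.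

(** * Polynomials over F annihilating an element of D *)

Lemma minimal_annihilator (F : fieldType) (D : falgType F) (P : {poly F})
    (x : D) :
  P != 0 -> root_in P x ->
  exists p : {poly F}, [/\ p != 0, root_in p x
    & forall r, root_in r x -> (size r < size p)%N -> r = 0].
Proof.
elim: {P}_.+1 {-2}P (ltnSn (size P)) => // N IH P leN P0 rP.
have [[r [r0 rr ltr]]|no] :=
  classic (exists r, [/\ r != 0, root_in r x & (size r < size P)%N]).
  exact: IH (leq_trans ltr leN) r0 rr.
exists P; split=> // r rr ltr; apply/eqP/negPn/negP => r0.
by case: no; exists r.
Qed.

Lemma root_in_modp (F : fieldType) (D : falgType F) (p P : {poly F}) (x : D) :
  root_in p x -> root_in P x -> root_in (P %% p) x.
Proof.
rewrite /root_in => /rootP px /rootP.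
(* Over D, evaluation at x respects a product once the value of the right factor commutes with x;
   that value is p(x) = 0. *)
rewrite {1}(divp_eq P p) rmorphD rmorphM /= hornerD hornerM_comm.
  by rewrite px mulr0 add0r => /rootP.
by rewrite /comm_poly px mulr0 mul0r.
Qed.

Lemma root_in_size_gt1 (F : fieldType) (D : falgType F) (p : {poly F}) (x : D) :
  p != 0 -> root_in p x -> (1 < size p)%N.
Proof.
move=> p0 /rootP px; rewrite ltnNge; apply: contra p0 => /size1_polyC pc.
move: px; rewrite pc map_polyC hornerC /= => /eqP.
by rewrite scaler_eq0 oner_eq0 orbF => /eqP->.
Qed.

(** The value is the sum of A_i y x^i, so this is injectivity of D tensor F[x] into End_F(D), by the
    shortest-relation argument. *)
Lemma sandwich_sum_eq0 (F : fieldType) (D : falgType F) (hD : central_division D)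
    (p : {poly F}) (x : D) (A : {poly D}) :
    (forall r, root_in r x -> (size r < size p)%N -> r = 0) ->
    (forall y : D, (A * y%:P).[x] = 0) -> (size A < size p)%N ->
  A = 0.
Proof.
move=> p_min.
elim: {A}_.+1 {-2}A (ltnSn (size A)) => // N IH A leN annA ltA.
apply/eqP/negPn/negP => A0.
have Uc : lead_coef A \is a GRing.unit by apply: hD.1; rewrite lead_coef_eq0.
pose B : {poly D} := (lead_coef A)^-1 *: A.
have sB : size B = size A.
  by apply/lreg_size/mulrI; rewrite unitrV.
have lB : B`_(size A).-1 = 1 by rewrite coefZ mulVr.
have annB y : (B * y%:P).[x] = 0 by rewrite /B -scalerAl hornerZ annA mulr0.
(* Leading terms cancel in the commutator, so by induction it vanishes and the
   coefficients of B are central. *)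
have cB y : B * y%:P = y%:P * B.
  apply/eqP; rewrite -subr_eq0; apply/eqP.
  have ltE : (size (B * y%:P - y%:P * B)%R < size A)%N.
    have sA : (0 < size A)%N by rewrite size_poly_gt0.
    rewrite -(prednK sA) ltnS; apply/leq_sizeP => j.
    rewrite leq_eqVlt => /predU1P[<-|lt].
      by rewrite coefB coefMC coefCM lB mulr1 mul1r subrr.
    have Bj : B`_j = 0 by apply: nth_default; rewrite sB -(prednK sA).
    by rewrite coefB coefMC coefCM Bj mulr0 mul0r subrr.
  apply: IH; first exact: leq_trans ltE _.
    move=> z; rewrite mulrBl hornerD hornerN -!mulrA -polyCM annB.
    by rewrite mul_polyC hornerZ annB mulr0 subrr.
  exact: ltn_trans ltE ltA.
have [b bP] : exists b : nat -> F, forall i, B`_i = (b i)%:A.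
  have ex i : exists a : F, B`_i = a%:A.
    by apply: hD.2 => y; rewrite -coefMC cB coefCM.
  have ex' i : exists a : F, B`_i == a%:A by have [a ->] := ex i; exists a.
  by exists (fun i => xchoose (ex' i)) => i; apply/eqP/(xchooseP (ex' i)).
pose r := \poly_(i < size A) b i.
have rB : map_poly (in_alg D) r = B.
  apply/polyP => i; rewrite coef_map coef_poly /= bP.
  case: ltnP => // le; rewrite scale0r -bP nth_default // sB //.
(* The relation at y = 1 reads r(x) = 0, and r is shorter than p; but B has a coefficient 1. *)
have r0 : r = 0.
  apply: p_min; last exact: leq_ltn_trans (size_poly _ _) ltA.
  by rewrite /root_in rB; apply/rootP; rewrite -[B]mulr1 -polyC1 annB.
by move: lB; rewrite -rB r0 rmorph0 coef0 => /eqP; rewrite eq_sym oner_eq0.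
Qed.

(* T q v stands for q(C) v; M_n(D) carries no F-algebra structure in which q
   could be evaluated at C directly. *)
Record poly_action (F : fieldType) (D : falgType F) (n : nat) (C : 'M[D]_n)
    (T : {poly F} -> 'cV[D]_n -> 'cV[D]_n) : Prop := {
  actD : forall q r v, T (q + r) v = T q v + T r v;
  actMX : forall q v, T (q * 'X) v = C *m T q v;
  actC : forall a v, T a%:P v = a%:A *: v }.

Lemma act_eigenvector (F : fieldType) (D : falgType F) (n : nat)
    (C : 'M[D]_n) (T : {poly F} -> 'cV[D]_n -> 'cV[D]_n)
    (hT : poly_action C T) (x : D) (v : 'cV[D]_n) (q : {poly F}) :
  C *m v = v *m x%:M -> T q v = v *m ((map_poly (in_alg D) q).[x])%:M.
Proof.
have sc a : a%:A *: v = v *m (a%:A : D)%:M.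
  by apply/colP=> i; rewrite !mxE big_ord1 !mxE mulr1n
             -scalerAl mul1r -scalerAr mulr1.
move=> Cv; elim/poly_ind: q => [|q c IH].
  rewrite (_ : T 0 v = T 0%:P v) ?polyC0 // (actC hT) sc.
  by rewrite rmorph0 horner0 scale0r.
rewrite (actD hT) (actMX hT) (actC hT) IH mulmxA Cv sc.
rewrite rmorphD rmorphM /= map_polyX map_polyC /= hornerMXaddC.
rewrite raddfD mulmxDr; congr (_ + _).
rewrite -mulmxA -scalar_mxM; congr (v *m _%:M).
(* Left to show: x q(x) = q(x) x, as the coefficients of q are central. *)
elim/poly_ind: q {IH} => [|q a IH].
  by rewrite rmorph0 horner0 mulr0 mul0r.
rewrite rmorphD rmorphM /= map_polyX map_polyC /= hornerMXaddC.
by rewrite mulrDl mulrDr mulrA IH -scalerAl mul1r -scalerAr mulr1.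
Qed.

(** * Construction of an eigenvector *)

Lemma exists_eigenvector (F : fieldType) (D : falgType F)
    (hD : central_division D) (n : nat) (C : 'M[D]_n)
    (T : {poly F} -> 'cV[D]_n -> 'cV[D]_n) (hT : poly_action C T)
    (p : {poly F}) (x : D) (w : 'cV[D]_n) :
    p != 0 -> root_in p x ->
    (forall r, root_in r x -> (size r < size p)%N -> r = 0) ->
    w != 0 -> T p w = 0 ->
  exists2 v : 'cV[D]_n, v != 0 & C *m v = v *m x%:M.
Proof.
move=> p0 px p_min w0 Tpw; have p_gt1 := root_in_size_gt1 p0 px.
(* The u i.+1 are the coefficients of p(t) / (t - C), applied to w. *)
pose u i := T (drop_poly i p) w.
have uS i : C *m u i.+1 = u i - (p`_i)%:A *: w.
  have -> : u i = T (drop_poly i.+1 p * 'X + (p`_i)%:P) w.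
    congr (T _ w); apply/polyP => -[|j].
      by rewrite coefD coefMX coefC coef_drop_poly add0r.
    by rewrite coefD coefMX coefC /= addr0 !coef_drop_poly addnS.
  by rewrite (actD hT) (actMX hT) (actC hT) addrK.
have u0 : u 0 = 0 by rewrite /u drop_poly0l.
have us : u (size p) = 0.
  by rewrite /u drop_poly_eq0 // -[0]polyC0 (actC hT) !scale0r.
(* This is S(w d): the quotient p(t) / (t - C) with t acting as right multiplication by x. *)
pose V d := \sum_(i < size p) u i.+1 *m (d * x ^+ i)%:M.
have CV d : C *m V d = V d *m x%:M.
  (* Since [u 0] and [u (size p)] vanish, both sides shift to sums of u_i d x^i, differing by w d
     p(x) = 0. *)
  have -> : V d *m x%:M = \sum_(i < (size p).+1) u i *m (d * x ^+ i)%:M.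
    rewrite big_ord_recl u0 mul0mx add0r mulmx_suml; apply: eq_bigr => i _.
    by rewrite -mulmxA -scalar_mxM -mulrA -exprSr.
  rewrite big_ord_recr /= us mul0mx addr0 {1}/V mulmx_sumr.
  pose W i := (p`_i)%:A *: w *m (d * x ^+ i)%:M.
  transitivity (\sum_(i < size p) (u i *m (d * x ^+ i)%:M - W i)).
    by apply: eq_bigr => i _; rewrite mulmxA uS mulmxBl.
  rewrite sumrB; apply/subr0_eq; rewrite addrAC subrr add0r.
  suff -> : \sum_(i < size p) W i = 0 by rewrite oppr0.
  have /rootP := px; rewrite horner_coef size_map_poly => px0.
  pose pD := map_poly (in_alg D) p.
  transitivity (w *m (d * \sum_(i < size p) pD`_i * x ^+ i)%:M).
    rewrite mulr_sumr raddf_sum mulmx_sumr; apply: eq_bigr => i _.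
    apply/colP => j; rewrite coef_map !mxE !big_ord1 !mxE !mulr1n /=.
    by rewrite -!scalerAl !mul1r -!scalerAr.
  by rewrite px0 mulr0 raddf0 mulmx0.
apply: NNPP => no; case/eqP: w0; apply/colP => k; rewrite mxE.
have V0 d : V d = 0.
  by apply/eqP/negPn/negP => V0; case: no; exists (V d).
have sp : size p = (size p).-1.+1 by rewrite prednK // ltnW.
(* Entry k of [V d] is [(A * d%:P).[x]]; leaving out the zero term [u (size p)] makes A shorter than
   p. *)
pose A := \poly_(i < (size p).-1) u i.+1 k 0.
have A0 : A = 0.
  apply: (sandwich_sum_eq0 (x := x) hD p_min); last first.
    by rewrite [ltnRHS]sp ltnS size_poly.
  move=> d; have := V0 d => /(congr1 (fun M : 'cV_n => M k 0)).
  rewrite summxE mxE sp big_ord_recr /= -sp us mul0mx mxE addr0 => eqV.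
  rewrite -[RHS]eqV (horner_coef_wide (n := (size p).-1)); last first.
    apply/leq_sizeP => j le_j.
    by rewrite coefMC nth_default ?mul0r // (leq_trans (size_poly _ _)).
  apply: eq_bigr => i _.
  by rewrite coefMC coef_poly ltn_ord !mxE big_ord1 !mxE mulr1n mulrA.
have sp2 : (size p).-1 = (size p).-2.+1 by rewrite prednK // -ltnS -sp.
have := congr1 (fun q : {poly D} => q`_(size p).-2) A0.
rewrite coef0 coef_poly -sp2.
(* The top coefficient of A is the leading coefficient of p times w_k, so A = 0 forces w_k = 0. *)
have -> : u (size p).-1 = (lead_coef p)%:A *: w.
  rewrite -(actC hT); congr (T _ w); apply/polyP => -[|j].
    by rewrite coef_drop_poly coefC.
  by rewrite coef_drop_poly coefC /= nth_default // addSn -addnS -sp leq_addl.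
rewrite sp2 ltnSn mxE -scalerAl mul1r => /eqP.
by rewrite scaler_eq0 lead_coef_eq0 (negPf p0) => /eqP.
Qed.

(** * Passage between D^n and K^(nd) *)

(** The unit of K is [algid K], a nonzero idempotent, which in a division algebra must be 1. *)
Lemma subfield_val_in_alg (F : fieldType) (D : falgType F)
    (hD : central_division D) (K : {aspace D}) (hK : maximal_subfield K)
    (a : F) :
  subfield_val (in_alg (subfield_type hD hK) a) = a%:A.
Proof.
have K1 : algid K = 1.
  exact: unitr_algid1 (memv_algid K) (hD.1 _ (algid_neq0 K)).
by rewrite -K1.
Qed.

Lemma det_sub_z_char_poly (F : fieldType) (D : falgType F)
    (hD : central_division D) (K : {aspace D}) (hK : maximal_subfield K)
    (m : nat) (M : 'M[subfield_type hD hK]_m) :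
  det_sub_z M = (-1) ^+ m *: char_poly M.
Proof. by rewrite -mul_polyC polyC_exp polyCN -detZ scaleN1r opprB. Qed.

(** Gathers what is wanted from K and g: [T q] is q(M) transported along g, Cayley-Hamilton kills
    [T Phi], and a zero determinant gives a kernel vector. *)
Lemma char_poly_div_action (F : fieldType) (D : falgType F)
    (hD : central_division D) (d n : nat) (C : 'M[D]_n) (Phi : {poly F}) :
    (0 < n)%N -> char_poly_div hD d C Phi ->
  exists T : {poly F} -> 'cV[D]_n -> 'cV[D]_n,
    [/\ poly_action C T, Phi != 0, forall v, T Phi v = 0
      & forall p, p %| Phi -> (1 < size p)%N ->
          exists2 w : 'cV[D]_n, w != 0 & T p w = 0].
Proof.
move=> n_gt0 [K [hK [g [M [[gD gZ [h gK hK']] gM PhiE]]]]].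
(* [horner_mx] takes size m.+1; n * d = 0 would make the nonzero space D^n trivial. *)
move: (n * d)%N g M h gD gZ gK hK' gM PhiE => [|m] g M h gD gZ gK hK' gM PhiE.
  have : const_mx 1 = 0 :> 'cV[D]_n.
    by apply: (can_inj gK); rewrite [LHS]flatmx0 [RHS]flatmx0.
  move/colP/(_ (Ordinal n_gt0)); rewrite !mxE => /eqP.
  by rewrite oner_eq0.
have g0 : g 0 = 0 by apply: (@addrI _ (g 0)); rewrite -gD !addr0.
have gZF a v : g (a%:A *: v) = in_alg (subfield_type hD hK) a *: g v.
  rewrite -gZ; congr g; apply/colP => i; rewrite !mxE subfield_val_in_alg.
  by rewrite -scalerAl mul1r -scalerAr mulr1.
pose KP := map_poly (in_alg (subfield_type hD hK)).
have PhiM : KP Phi = (-1) ^+ m.+1 *: char_poly M.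
  by rewrite -det_sub_z_char_poly.
have eqPhi : KP Phi %= char_poly M.
  by rewrite PhiM eqp_scale ?signr_eq0.
pose T q v := h (horner_mx M (KP q) *m g v).
exists T; split.
- split=> [q r v|q v|a v]; apply: (can_inj gK); rewrite ?gD ?gM ?gZF /T !hK'.
  + by rewrite /KP !rmorphD mulmxDl.
  + rewrite mulmxA /KP !rmorphM /= map_polyX horner_mx_X.
    by congr (_ *m _); apply/comm_horner_mx/comm_mx_refl.
  + by rewrite /KP map_polyC /= horner_mx_C mul_scalar_mx.
- rewrite -(map_poly_eq0 (in_alg (subfield_type hD hK))).
  rewrite [map_poly _ _]PhiM scaler_eq0 signr_eq0.
  by rewrite monic_neq0 ?char_poly_monic.
- move=> v; rewrite /T PhiM horner_mxZ Cayley_Hamilton scaler0 mul0mx.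
  by rewrite -g0 gK.
move=> p p_dvd p_gt1.
have : \det (horner_mx M (KP p)) = 0.
  apply: det_horner_mx_eq0; last by rewrite size_map_poly.
  by rewrite -(eqp_dvdr _ eqPhi) dvdp_map.
(* [det0P] gives a row kernel vector, hence the transposes. *)
rewrite -det_tr => /eqP/det0P[z z0 zM].
exists (h z^T).
  apply: contraNneq z0 => hz; rewrite -[z]trmxK -[z^T]hK' hz g0.
  by rewrite trmx0.
by rewrite /T hK' -[_ *m _]trmxK trmx_mul trmxK zM trmx0 -g0 gK.
Qed.

(** * Eigenvectors of the companion matrix *)

Lemma companionmx_root (D : nzRingType) (phi : {poly D}) (x : D) :
    phi \is monic -> root phi x ->
  companionmx phi *m (\col_i x ^+ i) = (\col_i x ^+ i) *m x%:M.
Proof.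
move=> mon /rootP; rewrite (horner_coef_wide _ (leqSpred _)).
rewrite big_ord_recr /= -lead_coefE (monicP mon) mul1r => px.
apply/colP => i; rewrite !mxE big_ord1 !mxE mulr1n -exprSr.
have [i_last|i_nlast] := eqVneq (i : nat) (size phi).-2.
  under eq_bigr => j _ do rewrite !mxE i_last eqxx mulNr.
  rewrite sumrN i_last.
  have -> : (size phi).-2.+1 = (size phi).-1.
    exact: prednK (leq_ltn_trans (leq0n i) (ltn_ord i)).
  by apply/eqP; rewrite eq_sym -subr_eq0 opprK addrC px.
have lt_i : (i.+1 < (size phi).-1)%N.
  rewrite ltn_neqAle ltn_ord andbT.
  by apply: contra i_nlast => /eqP/(congr1 predn)/eqP.
rewrite (bigD1 (Ordinal lt_i)) //= !mxE (negPf i_nlast) eqxx mul1r.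
rewrite big1 ?addr0 // => j nj; rewrite !mxE (negPf i_nlast).
rewrite (_ : (i.+1 == j) = false) ?mul0r //.
by apply: contraNF nj => /eqP ij; apply/eqP/val_inj.
Qed.

(** For invertible q the sum is phi(q x q^-1) q; this form makes sense over any nonzero ring. *)
Lemma companionmx_eigenvector (D : nzRingType) (phi : {poly D}) (x : D)
    (v : 'cV[D]_(size phi).-1) :
    phi \is monic -> companionmx phi *m v = v *m x%:M -> v != 0 ->
  exists2 q : D, q != 0 & \sum_(i < (size phi).-1.+1) phi`_i * q * x ^+ i = 0.
Proof.
move=> mon Cv v0.
have n0 : (0 < (size phi).-1)%N.
  rewrite lt0n; apply: contraNneq v0 => s0; apply/eqP/colP => i.
  by have := ltn_ord i; rewrite [X in (_ < X)%N]s0.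
have sp2 : (size phi).-1 = (size phi).-2.+1 by rewrite prednK.
have row i : (companionmx phi *m v) i 0 = v i 0 * x.
  by rewrite Cv !mxE big_ord1 !mxE mulr1n.
pose q := v (Ordinal n0) 0.
have vE (i : 'I_(size phi).-1) : v i 0 = q * x ^+ i.
  case: i => i; elim: i => [|i IH] lt_i.
    by rewrite mulr1; congr (v _ 0); apply: val_inj.
  have := row (Ordinal (ltnW lt_i)); rewrite IH mxE -mulrA -exprSr => <-.
  have ni : (i == (size phi).-2) = false.
    by apply/negbTE; rewrite neq_ltn -ltnS -sp2 lt_i.
  rewrite (bigD1 (Ordinal lt_i)) //= !mxE ni eqxx mul1r.
  rewrite big1 ?addr0 // => j nj; rewrite !mxE ni.
  rewrite (_ : (i.+1 == j) = false) ?mul0r //.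
  by apply: contraNF nj => /eqP ij; apply/eqP/val_inj.
exists q.
  by apply: contraNneq v0 => q0; apply/eqP/colP => i; rewrite vE q0 mul0r mxE.
have lt_last : ((size phi).-2 < (size phi).-1)%N by rewrite {2}sp2.
have := row (Ordinal lt_last); rewrite vE /= -mulrA -exprSr -sp2 mxE.
rewrite (eq_bigr (fun j : 'I_(size phi).-1 => - (phi`_j * q * x ^+ j)));
  last by move=> j _; rewrite !mxE eqxx vE mulNr mulrA.
rewrite sumrN => /eqP; rewrite eq_sym -subr_eq0 opprK addrC => /eqP sum0.
rewrite -[RHS]sum0 big_ord_recr /=; congr (_ + _).
by rewrite -lead_coefE (monicP mon) mul1r.
Qed.

Theorem theorem3p6 (F : fieldType) (D : falgType F)
    (hD : central_division D) (d : nat) (hd : division_degree D d)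
    (n : nat) (hn : (0 < n)%N)
    (phi : {poly D}) (hmonic : phi \is monic) (hsize : size phi = n.+1)
    (Phi : {poly F}) (hPhi : companion_poly hD d phi Phi) :
  (forall x : D, root phi x -> root_in Phi x) /\
  (forall x : D, root_in Phi x ->
     exists y : D, conjugate y x /\ root phi y).
Proof.
have n0 : (0 < (size phi).-1)%N by rewrite hsize.
have [T [hT Phi0 TPhi Tker]] := char_poly_div_action n0 hPhi.
split=> x px.
  (* The eigenvector has first entry x^0 = 1, so the first entry of [T Phi] on it is Phi(x). *)
  have := act_eigenvector hT Phi (companionmx_root hmonic px).
  rewrite TPhi => /colP/(_ (Ordinal n0)).
  by rewrite !mxE big_ord1 !mxE mulr1n mul1r => /esym/rootP.
have [p [p0 rp p_min]] := minimal_annihilator Phi0 px.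
have p_dvd : p %| Phi.
  by apply/modp_eq0P/p_min; [apply: root_in_modp | rewrite ltn_modp].
have [w w0 Tpw] := Tker p p_dvd (root_in_size_gt1 p0 rp).
have [v v0 Cv] := exists_eigenvector hD hT p0 rp p_min w0 Tpw.
have [q q0 phiq] := companionmx_eigenvector hmonic Cv v0.
have Uq : q \is a GRing.unit by apply: hD.1.
exists (q * x * q^-1); split; first by exists q.
(* Right multiplication by q turns (q x q^-1)^i into q x^i. *)
apply/rootP/(mulIr Uq); rewrite mul0r -phiq.
rewrite (horner_coef_wide _ (leqSpred _)) mulr_suml.
apply: eq_bigr => i _; rewrite -!mulrA; congr (_ * _).
elim: (i : nat) => [|k IH]; first by rewrite !expr0 mul1r mulr1.
by rewrite !exprS -mulrA IH !mulrA divrK.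
Qed.
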